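(* Let $r\in[2,\infty)$, let $(X,\|\cdot\|)$ be an $r$-uniformly convex Banach space with constant $c_r$ satisfying Opial's property, and let $T:X\to X$ be a nonexpansive operator. If $T$ is quasi $\alpha$-firmly nonexpansive for some $\alpha\in(0,1)$, then for any $x_0\in X$ the iterates $x_{n+1}:=Tx_n$, $n=0,1,2,\dots$, converge weakly to an element $x^*\in\mathrm{Fix}\,T$. Moreover, if $\bar x_n:=P_{\mathrm{Fix}\,T}x_n$ for all $n$, then $\lim_{n\to\infty}\bar x_n=x^*$ (in norm).
   Context: For $r\in[2,\infty)$, a normed space $(X,\|\cdot\|)$ is called $r$-uniformly convex (with constant $c_r$) if there is a constant $c_r>0$ such that for all $w\in[0,1]$ and all $x,y\in X$ $$\|(1-w)x+wy\|^r\le(1-w)\|x\|^r+w\|y\|^r-\frac{c_r}{2}w(1-w)\|x-y\|^r.$$ The constant $c_r$ is fixed. Operators are maps $X\to X$, not necessarily linear; $\mathrm{Fix}\,T=\{x\in X:Tx=x\}$; $\mathrm{I}$ is the identity. $T$ is nonexpansive if $\|Tx-Ty\|\le\|x-y\|$ for all $x,y\in X$. For $\alpha\in(0,1)$, $T:X\to X$ is quasi $\alpha$-firmly nonexpansive if $\mathrm{Fix}\,T\ne\emptyset$ and for all $x\in X$ and all $y\in\mathrm{Fix}\,T$ $$\|Tx-Ty\|^r\le\|x-y\|^r-\frac{c_r}{2}\,\frac{1-\alpha}{\alpha}\,\|(\mathrm{I}-T)x-(\mathrm{I}-T)y\|^r.$$ A Banach space $X$ satisfies Opial's property if, whenever a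 sequence $(x_n)$ in $X$ converges weakly to $x\in X$, one has $\liminf_{n\to\infty}\|x_n-x\|<\liminf_{n\to\infty}\|x_n-y\|$ for all $y\in X\setminus\{x\}$. For a nonempty closed convex set $C\subseteq X$, $P_Cx$ denotes the unique point of $C$ with minimal distance to $x$ (it exists and is unique in $r$-uniformly convex Banach spaces; $\mathrm{Fix}\,T$ is nonempty, closed and convex for quasi $\alpha$-firmly nonexpansive $T$). *)

(* Defs.v *)
From HB Require Import structures.
From mathcomp Require Import all_boot all_order all_algebra.
From mathcomp Require Import all_classical all_reals all_analysis.

Set Implicit Arguments.
Unset Strict Implicit.
Unset Printing Implicit Defensive.

Import Order.TTheory GRing.Theory Num.Theory.
Import numFieldNormedType.Exports.

Local Open Scope classical_set_scope.
Local Open Scope ring_scope.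

Definition uniformly_convex (R : realType) (X : normedModType R) (r c : R) :=
  0 < c /\
  forall (w : R) (x y : X), 0 <= w <= 1 ->
    `|(1 - w) *: x + w *: y| `^ r <=
      (1 - w) * `|x| `^ r + w * `|y| `^ r
      - c / 2 * w * (1 - w) * `|x - y| `^ r.

Definition Fix (X : Type) (T : X -> X) : set X := [set x | T x = x].

Definition nonexpansive (R : realType) (X : normedModType R) (T : X -> X) :=
  forall x y : X, `|T x - T y| <= `|x - y|.

Definition quasi_firmly_nonexpansive (R : realType) (X : normedModType R)
    (r c alpha : R) (T : X -> X) :=
  0 < alpha < 1 /\ Fix T !=set0 /\
  forall x y : X, Fix T y ->
    `|T x - T y| `^ r <=
      `|x - y| `^ r
      - c / 2 * ((1 - alpha) / alpha) * `|(x - T x) - (y - T y)| `^ r.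

(* Sequential convergence in the weak topology, tested against all continuous
   linear functionals; R^o is R viewed as a module over itself. *)
Definition weakly_cvg (R : realType) (X : normedModType R)
    (u : nat -> X) (x : X) :=
  forall f : {linear X -> R^o}, continuous f -> f (u n) @[n --> \oo] --> f x.

(* The inferior limits are taken in \bar R, where they always exist. *)
Definition opial (R : realType) (X : normedModType R) :=
  forall (u : nat -> X) (x : X), weakly_cvg u x ->
  forall y : X, y <> x ->
    (limn_einf (fun n => `|u n - x|%:E) < limn_einf (fun n => `|u n - y|%:E))%E.

Definition nearest_points (R : realType) (X : normedModType R)
    (C : set X) (x : X) : set X :=
  [set p | C p /\ forall z, C z -> `|x - p| <= `|x - z|].

(* The value 0 is only taken when x has no nearest point in C; when the nearest
   point exists and is unique, this is that point. *)
Definition metric_proj (R : realType) (X : normedModType R)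
    (C : set X) (x : X) : X :=
  xget 0 (nearest_points C x).

(* Main.v *)
Require Import Defs.
From HB Require Import structures.
From mathcomp Require Import all_boot all_order all_algebra.
From mathcomp Require Import all_classical all_reals all_analysis.
From mathcomp Require Import lra.

Set Implicit Arguments.
Unset Strict Implicit.
Unset Printing Implicit Defensive.

Import Order.TTheory GRing.Theory Num.Theory.
Import numFieldNormedType.Exports.

Local Open Scope classical_set_scope.
Local Open Scope ring_scope.

(** Write x n for the orbit of x0. It is Fejer monotone with respect to Fix T,
    and the quasi firm nonexpansiveness makes x n - T (x n) vanish. Uniform
    convexity at midpoints bounds the distance between the projections of x n and
    x m on Fix T in terms of the decrease, from n to m, of the distance to Fix T, so these
    projections form a Cauchy sequence ([projections_cvg]); let p be its limit.

    Opial's property then identifies every weak limit z of a sequence v that is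
    eventually contained in each tail of the orbit. First z is fixed by T, since
    the distances from v n to T z exceed those to z by at most
    |v n - T (v n)|, which tends to 0 ([weak_limit_in_Fix]). Next z = p, since
    the distances from v n to p exceed those to the projection of v n, hence
    those to the fixed point z, by a vanishing amount
    ([weak_limit_projections]).

    It remains to know that bounded sequences have weakly convergent
    subsequences ([bounded_weakly_cvg_refinement]): if f (x n) did not tend to
    f p for some functional f, a subsequence kept away from f p could be refined
    to a weakly convergent one, whose limit would be p, a contradiction. To
    prove this compactness, attach to a bounded sequence u its core, the
    intersection of the closed convex hulls of its tails, which is nonempty because nested bounded closed convex sets
    meet ([nearest_point_bigcap]). Refining u shrinks the core, hence increases
    the norm of the core's point nearest to the origin, the center of u. A
    diagonal argument gives a refinement v for which this norm cannot increase
    any more; as the nearest point is unique, the center of v then lies in the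
    core of every refinement of v. A closed convex set that contains v infinitely
    often contains the core of a refinement of v, hence the center. Applied to
    half-spaces, this says that v converges weakly to its center. *)

(** * Vanishing quantities and inferior limits *)

(** Extracts a vanishing quantity from a vanishing bound on its [r]-th power; it
    serves wherever uniform convexity or firmness bounds such a power. *)
Lemma near_lt_of_powR_le (R : realType) (r k eps : R) (e : R^nat) :
  0 < r -> 0 < k -> 0 < eps -> e @ \oo --> 0 ->
  \forall n \near \oo, forall t, 0 <= t -> k * t `^ r <= e n -> t < eps.
Proof.
move=> r0 k0 eps0 e0.
have : \forall n \near \oo, e n < k * eps `^ r.
  by apply: (cvgr_lt 0 e0); rewrite mulr_gt0 // powR_gt0.
apply: filterS => n en t t0 /le_lt_trans /(_ en).
rewrite ltr_pM2l //; apply: contraTT; rewrite -!leNgt => epst.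
by apply: ge0_ler_powR; rewrite ?nnegrE // ltW.
Qed.

Lemma ler_powR_norm (R : realType) (X : normedModType R) (r : R) (x y : X) :
  0 < r -> `|x| `^ r <= `|y| `^ r -> `|x| <= `|y|.
Proof.
move=> r0; apply: contraTT; rewrite -!ltNge => yx.
by apply: gt0_ltr_powR; rewrite ?nnegrE.
Qed.

(** A perturbation below [e] from some index on raises the inferior limit by at
    most [e]. The inferior limit being minus an infimum over neighborhoods of
    infinity, each neighborhood is shrunk to one where the perturbation is small. *)
Lemma limn_einf_le_vanishing {R : realType} {a b d : R^nat} :
  d @ \oo --> 0 -> (\forall n \near \oo, a n <= b n + d n) ->
  (limn_einf (fun n => (a n)%:E) <= limn_einf (fun n => (b n)%:E))%E.
Proof.
move=> d0 ab; apply/lee_addgt0Pr => e e0.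
rewrite addeC -limn_einf_shift // leeN2.
apply: le_ereal_inf_tmp => _ [V FV <-].
pose W := V `&` [set n | a n <= b n + e].
have FW : \oo W.
  apply: filterI => //; near=> n.
  have : a n <= b n + d n by near: n.
  move=> /le_trans; apply; rewrite lerD2l.
  by near: n; apply: (cvgr_le 0 d0).
apply: le_trans (ereal_inf_lbound _) _; first by exists W.
apply: ge_ereal_sup => _ [n [Vn abn] <-].
apply: le_trans (ereal_sup_ubound _); last by exists n.
by rewrite -EFinD -!EFinN lee_fin lerN2 addrC.
Unshelve. all: by end_near.
Qed.

(** * Nearest points in uniformly convex spaces *)

(** For closed sets, stability under midpoints amounts to convexity, and
    midpoints are all that the arguments below ever use. *)
Definition midconvex {R : realType} {X : normedModType R} (C : set X) :=
  forall x y, C x -> C y -> C (2^-1 *: (x + y)).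

Section UniformlyConvex.
Context {R : realType} {X : completeNormedModType R} {r c : R}.
Hypotheses (hr : 2 <= r) (hX : uniformly_convex X r c).

Let r_gt0 : 0 < r. Proof. exact: lt_le_trans hr. Qed.
Let c8_gt0 : 0 < c / 8. Proof. by case: hX => c0 _; lra. Qed.

(** Uniform convexity at weight 1/2, seen from a center [a]. *)
Lemma dist_midpoint (a x y : X) :
  `|a - 2^-1 *: (x + y)| `^ r <=
    2^-1 * `|a - x| `^ r + 2^-1 * `|a - y| `^ r - c / 8 * `|x - y| `^ r.
Proof.
have w01 : 0 <= (2^-1 : R) <= 1 by lra.
have := (proj2 hX) _ (a - x) (a - y) w01.
have -> : 1 - 2^-1 = 2^-1 :> R by lra.
have -> : 2^-1 *: (a - x) + 2^-1 *: (a - y) = a - 2^-1 *: (x + y).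
  rewrite !scalerBr addrACA -scalerDl -opprD -scalerDr.
  by have -> : 2^-1 + 2^-1 = 1 :> R by [lra]; rewrite scale1r.
have -> : (a - x) - (a - y) = y - x by rewrite opprB addrC subrKA.
by rewrite (distrC y) => /le_trans; apply; lra.
Qed.

Lemma cvgn_of_powR_le (y : nat -> X) (k : R) (e : R^nat) : 0 < k ->
  e @ \oo --> 0 ->
  (forall n m, (n <= m)%N -> k * `|y n - y m| `^ r <= e n) ->
  cvgn y.
Proof.
move=> k0 e0 ye; apply: cauchy_cvg; apply: cauchy_exP => eps eps0.
have [N _ HN] := near_lt_of_powR_le r_gt0 k0 eps0 e0.
exists (y N); exists N => // m /= Nm.
by rewrite -ball_normE /=; apply: (HN N) => //=; exact: ye.
Qed.

(** Completeness turns uniform convexity into a compactness property: take [y n]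
    in [B n] whose distance to [a], raised to the power [r], is within
    [1 / (n + 1)] of the infimum [D n] over [B n]. The sequence [D] is
    nondecreasing and bounded by [M `^ r], and for [n <= m] the midpoint of
    [y n] and [y m] is in [B n], so that [dist_midpoint] bounds [|y n - y m|] in
    terms of [lim D - D n + 1 / (n + 1)]. A constant family gives the existence
    of projections. *)
Lemma nearest_point_bigcap (B : nat -> set X) (a : X) (M : R) :
  (forall n m, (n <= m)%N -> B m `<=` B n) ->
  (forall n, closed (B n)) -> (forall n, midconvex (B n)) ->
  (forall n, exists2 y, B n y & `|a - y| <= M) ->
  exists p, nearest_points (\bigcap_n B n) a p.
Proof.
move=> Bdec Bcl Bmid BM.
pose E n := [set `|a - y| `^ r | y in B n].
have En0 n : E n !=set0 by have [y By _] := BM n; exists (`|a - y| `^ r), y.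
have Elb n : lbound (E n) 0 by move=> _ [y _ <-]; exact: powR_ge0.
have Einf n : has_inf (E n) by split=> //; exists 0; exact: Elb.
pose D n := inf (E n).
have DE n y : B n y -> D n <= `|a - y| `^ r.
  by move=> By; apply: ge_inf; [exact: (Einf n).2|exists y].
have Dnd : {homo D : n m / (n <= m)%N >-> n <= m}.
  move=> n m nm; apply: lb_le_inf => // _ [y By <-].
  by apply: DE; exact: Bdec By.
have Dub : has_ubound (range D).
  exists (M `^ r) => _ [n _ <-]; have [y By yM] := BM n.
  apply: le_trans (DE _ _ By) _; apply: ge0_ler_powR => //; first exact: ltW.
    by rewrite nnegrE.
  by rewrite nnegrE (le_trans _ yM).
have Dcvg : cvgn D by exact: nondecreasing_is_cvgn.
pose L : R := limn D.
have DL n : D n <= L by exact: nondecreasing_cvgn_le.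
have ex n : exists y, B n y /\ `|a - y| `^ r < D n + n.+1%:R^-1.
  have [] := @inf_adherent _ (E n) n.+1%:R^-1 _ (Einf n).
    by rewrite invr_gt0.
  by move=> _ [y By <-] yD; exists y.
have [y yP] := choice ex.
pose e (n : nat) : R := L + n.+1%:R^-1 - D n.
have e0 : e @ \oo --> 0.
  rewrite -[X in _ --> X](subrr L) -[X in _ --> X - _]addr0.
  by apply: cvgB => //; apply: cvgD; [exact: cvg_cst|exact: cvg_harmonic].
have ye n m : (n <= m)%N -> c / 8 * `|y n - y m| `^ r <= e n.
  move=> nm; have [Bn yn] := yP n; have [Bm ym] := yP m.
  have := DE n _ (Bmid n _ _ Bn (Bdec _ _ nm _ Bm)).
  move=> /le_trans /(_ (dist_midpoint _ _ _)).
  have : m.+1%:R^-1 <= n.+1%:R^-1 :> R by rewrite lef_pV2 ?posrE // ler_nat.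
  have := DL m; have := DL n; move: yn ym; rewrite /e.
  by move: (n.+1%:R^-1) (m.+1%:R^-1) => u v; lra.
have ycvg : cvgn y by exact: (cvgn_of_powR_le c8_gt0 e0).
exists (limn y); split.
  move=> n _; apply: (closed_cvg _ (Bcl n) _ _ ycvg).
  by exists n => // m /= nm; apply: (Bdec _ _ nm); have [] := yP m.
move=> p Bp; apply: (@ler_powR_norm _ _ r) => //.
apply/ler_addgt0Pr => eps eps0.
(* The r-th root turns the bound into a closed condition on norms. *)
pose q := (`|a - p| `^ r + eps) `^ r^-1.
have pe0 : 0 <= `|a - p| `^ r + eps by rewrite addr_ge0 ?powR_ge0 // ltW.
have qr : q `^ r = `|a - p| `^ r + eps.
  by rewrite -powRrM mulVf ?gt_eqF // powRr1.
have q0 : 0 <= q by exact: powR_ge0.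
rewrite -qr; apply: ge0_ler_powR; rewrite ?nnegrE //; first exact: ltW.
have cy : `|a - y n| @[n --> \oo] --> `|a - limn y|.
  by apply: cvg_norm; apply: cvgB => //; exact: cvg_cst.
apply: (closed_cvg _ (@closed_le _ q) _ _ cy).
have : \forall n \near \oo, n.+1%:R^-1 < eps :> R.
  exact: (cvgr_lt 0 (@cvg_harmonic R)).
apply: filterS => n neps /=; have [Bn yn] := yP n.
rewrite leNgt; apply/negP => qy.
have : q `^ r < `|a - y n| `^ r by apply: gt0_ltr_powR; rewrite ?nnegrE.
rewrite qr; have := DE n _ (Bp n I); move: neps yn.
by move: (n.+1%:R^-1) => u; lra.
Qed.

Lemma nearest_points_unique (C : set X) (a p q : X) : midconvex C ->
  nearest_points C a p -> nearest_points C a q -> p = q.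
Proof.
move=> Cmid [Cp pmin] [Cq qmin].
have npq : `|a - p| = `|a - q| by apply/eqP; rewrite eq_le pmin // qmin.
have := pmin _ (Cmid _ _ Cp Cq).
move=> /(ge0_ler_powR (ltW r_gt0)).
rewrite !nnegrE !normr_ge0 => /(_ isT isT) /le_trans /(_ (dist_midpoint _ _ _)).
rewrite npq => h.
have : `|p - q| `^ r <= 0 by rewrite -(pmulr_rle0 _ c8_gt0); lra.
rewrite le_eqVlt ltNge powR_ge0 orbF powR_eq0 normr_eq0 subr_eq0.
by move=> /andP[/eqP].
Qed.

Lemma metric_projP (C : set X) (a : X) : C !=set0 -> closed C -> midconvex C ->
  nearest_points C a (metric_proj C a).
Proof.
move=> [y Cy] Ccl Cmid; apply: xgetPex.
have := @nearest_point_bigcap (fun _ : nat => C) a `|a - y|.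
rewrite bigcap_const; last by exists 0%N.
by apply=> [n m _ //|//|//|_]; exists y.
Qed.

End UniformlyConvex.

(** * Refinements of sequences *)

(** [v] is eventually in every set that eventually contains [u]. Every
    subsequence of [u] qualifies; unlike the subsequence relation, this one is
    insensitive to finitely many terms and needs no index maps. *)
Definition refines {X : Type} (v u : nat -> X) := v @ \oo `=>` u @ \oo.

Lemma refines_refl {X : Type} (u : nat -> X) : refines u u.
Proof. by []. Qed.

Lemma refines_trans {X : Type} (w v u : nat -> X) :
  refines w v -> refines v u -> refines w u.
Proof. by move=> wv vu A /vu /wv. Qed.

Lemma refines_cvg {X : Type} {Y : topologicalType} (u v : nat -> X)
    (g : X -> Y) (l : Y) :
  refines v u -> g (u n) @[n --> \oo] --> l -> g (v n) @[n --> \oo] --> l.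
Proof. by move=> vu gu A gA; exact: (vu (g @^-1` A) (gu A gA)). Qed.

Lemma refine_frequently {X : Type} (u : nat -> X) (P : set X) :
  ~ (\forall n \near \oo, P (u n)) ->
  exists v, refines v u /\ forall k, ~ P (v k).
Proof.
move=> nP; have ex N : exists n, (N <= n)%N /\ ~ P (u n).
  apply: contrapT => no; apply: nP; exists N => // n /= Nn.
  by apply: contrapT => nPn; apply: no; exists n.
have [phi phiP] := choice ex; exists (u \o phi); split=> [A|k].
  case=> N _ uA; exists N => // k /= Nk; apply: uA => /=.
  by apply: leq_trans Nk _; have [] := phiP k.
by have [] := phiP k.
Qed.

(** The [k]-th term of [w] is taken in the [k]-th tails of [V 0, ..., V k],
    which have a common point because [V k] is eventually in each of them. *)
Lemma refines_diagonal {X : Type} (V : nat -> nat -> X) :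
  (forall k, refines (V k.+1) (V k)) -> exists w, forall k, refines w (V k).
Proof.
move=> Vdec.
have Vle i k : (i <= k)%N -> refines (V k) (V i).
  elim: k => [|k IH]; first by rewrite leqn0 => /eqP ->.
  rewrite leq_eqVlt => /predU1P[->//|]; rewrite ltnS => /IH.
  exact: refines_trans.
have ex k : exists x, forall i : 'I_k.+1, sdrop (V i) k x.
  have /filter_ex[n Vn] : \forall n \near \oo, forall i : 'I_k.+1,
      sdrop (V i) k (V k n).
    apply: filter_forall => i; apply: (Vle i k); first by rewrite -ltnS.
    by exists k => // n /= kn; exists n.
  by exists (V k n).
have [w wP] := choice ex; exists w => i A [N _ VA].
exists (maxn i N) => // k /=; rewrite geq_max => /andP[ik Nk].
have [n /= kn <-] := wP k (Ordinal (ik : (i < k.+1)%N)).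
by apply: VA; exact: leq_trans kn.
Qed.

(** * The core of a sequence *)

(** The closed convex hull. *)
Definition closed_hull {R : realType} {X : normedModType R} (A : set X) :=
  \bigcap_(B in [set B | [/\ closed B, midconvex B & A `<=` B]]) B.

Definition tail_core {R : realType} {X : normedModType R} (u : nat -> X) :=
  \bigcap_n closed_hull (sdrop u n).

Section TailCore.
Context {R : realType} {X : normedModType R}.
Implicit Types u v : nat -> X.

Lemma midconvex_bigcap (I : Type) (D : set I) (B : I -> set X) :
  (forall i, D i -> midconvex (B i)) -> midconvex (\bigcap_(i in D) B i).
Proof.
by move=> Bmid x y Bx By i Di; apply: Bmid => //; [exact: Bx|exact: By].
Qed.

Lemma closed_closed_hull (A : set X) : closed (closed_hull A).
Proof. by apply: closed_bigI => B []. Qed.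

Lemma midconvex_closed_hull (A : set X) : midconvex (closed_hull A).
Proof. by apply: midconvex_bigcap => B []. Qed.

Lemma sub_closed_hull (A : set X) : A `<=` closed_hull A.
Proof. by move=> x Ax B [_ _]; apply. Qed.

Lemma closed_tail_core u : closed (tail_core u).
Proof. by apply: closed_bigI => n _; exact: closed_closed_hull. Qed.

Lemma midconvex_tail_core u : midconvex (tail_core u).
Proof. by apply: midconvex_bigcap => n _; exact: midconvex_closed_hull. Qed.

(** In particular, the value of a continuous functional on the core lies between
    its inferior and superior limits along [u]. *)
Lemma tail_core_sub u (B : set X) : closed B -> midconvex B ->
  (\forall n \near \oo, B (u n)) -> tail_core u `<=` B.
Proof.
move=> Bcl Bmid [N _ uB] y /(_ N I); apply; split=> // _ [k /= Nk <-].
exact: uB.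
Qed.

Lemma tail_core_refines u v : refines v u -> tail_core v `<=` tail_core u.
Proof.
move=> vu y vy n _ B [Bcl Bmid uB]; apply: tail_core_sub vy => //.
by apply: vu; exists n => // k /= nk; apply: uB; exists k.
Qed.

Lemma midconvex_norm_le (M : R) : midconvex [set y : X | `|y| <= M].
Proof.
move=> x y /= xM yM; rewrite normrZ ger0_norm ?invr_ge0 //.
have := ler_normD x y; lra.
Qed.

Lemma closed_norm_le (M : R) : closed [set y : X | `|y| <= M].
Proof.
apply: (@preimage_closed _ _ (fun y : X => `|y|) [set t | t <= M]).
  by move=> y _; exact: norm_continuous.
exact: closed_le.
Qed.

End TailCore.

(** * Weak sequential compactness of bounded sets *)

Section WeakCompactness.
Context {R : realType} {X : completeNormedModType R} {r c : R}.
Hypotheses (hr : 2 <= r) (hX : uniformly_convex X r c).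

Definition eventually_bounded (M : R) (u : nat -> X) :=
  \forall n \near \oo, `|u n| <= M.

Lemma refines_bounded (M : R) u v :
  refines v u -> eventually_bounded M u -> eventually_bounded M v.
Proof. by move=> vu; exact: (vu [set y | `|y| <= M]). Qed.

Definition center (u : nat -> X) := metric_proj (tail_core u) 0.

Lemma center_nearest (M : R) u : eventually_bounded M u ->
  nearest_points (tail_core u) 0 (center u).
Proof.
move=> uM; apply: xgetPex; apply: (nearest_point_bigcap hr hX (M := M)).
- move=> n m nm y ymu B [Bcl Bmid uB]; apply: ymu; split=> //.
  by move=> _ [k /= mk <-]; apply: uB; exists k => //=; exact: leq_trans mk.
- by move=> n; exact: closed_closed_hull.
- by move=> n; exact: midconvex_closed_hull.
- move=> n; have /filter_ex[k [uk nk]] : \forall k \near \oo,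
      `|u k| <= M /\ (n <= k)%N.
    by apply: filterI => //; exists n.
  exists (u k); last by rewrite sub0r normrN.
  by apply: sub_closed_hull; exists k.
Qed.

Lemma norm_center_le (M : R) u : eventually_bounded M u -> `|center u| <= M.
Proof.
move=> uM; have [cu _] := center_nearest uM.
apply: (tail_core_sub (B := [set y | `|y| <= M]) _ _ uM cu).
  exact: closed_norm_le.
exact: midconvex_norm_le.
Qed.

(** The core of [v] is smaller, hence further away from the origin. *)
Lemma norm_center_refines (M : R) u v : eventually_bounded M u ->
  refines v u -> `|center u| <= `|center v|.
Proof.
move=> uM vu; have [_ /(_ (center v))] := center_nearest uM.
rewrite !sub0r !normrN; apply; apply: (tail_core_refines vu).
by have [] := center_nearest (refines_bounded vu uM).
Qed.

(** [v] nearly attains the supremum of the norms of the centers over all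
    refinements of [u]. *)
Lemma exists_almost_regular (M eps : R) u : eventually_bounded M u -> 0 < eps ->
  exists v, refines v u /\
    forall w, refines w u -> `|center w| <= `|center v| + eps.
Proof.
move=> uM eps0; pose S := [set `|center v| | v in [set v | refines v u]].
have Ssup : has_sup S.
  split; first by exists `|center u|, u => //; exact: refines_refl.
  exists M => _ [v /= vu <-]; apply: norm_center_le.
  exact: refines_bounded uM.
have [_ [v /= vu <-] vS] := sup_adherent eps0 Ssup.
exists v; split=> // w wu; have : `|center w| <= sup S.
  by apply: ub_le_sup; [exact: Ssup.2|exists w].
lra.
Qed.

(** Iterating [exists_almost_regular] with margins [1 / (k + 1)] and taking a
    diagonal refinement leaves no room for the norm of the center to grow. *)
Lemma exists_regular (M : R) u : eventually_bounded M u ->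
  exists v, refines v u /\
    forall w, refines w v -> `|center w| <= `|center v|.
Proof.
move=> uM.
have ex (kv : nat * (nat -> X)) : exists v, eventually_bounded M kv.2 ->
    refines v kv.2 /\
    forall w, refines w kv.2 -> `|center w| <= `|center v| + kv.1.+1%:R^-1.
  have [kvM|nkvM] := pselect (eventually_bounded M kv.2); last by exists u.
  have [|v vP] := exists_almost_regular (eps := kv.1.+1%:R^-1) kvM.
    by rewrite invr_gt0.
  by exists v.
have [next nextP] := choice ex.
pose V := fix V k := if k is j.+1 then next (j, V j) else u.
have VM k : eventually_bounded M (V k).
  elim: k => // k IH; have [VV _] := nextP (k, V k) IH.
  exact: refines_bounded IH.
have [v vV] : exists v, forall k, refines v (V k).
  by apply: refines_diagonal => k; have [] := nextP (k, V k) (VM k).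
exists v; split=> [|w wv]; first exact: (vV 0%N).
apply/ler_addgt0Pr => eps eps0.
have /filter_ex[k keps] : \forall k \near \oo, k.+1%:R^-1 < eps :> R.
  exact: (cvgr_lt 0 (@cvg_harmonic R)).
have [_ /(_ w (refines_trans wv (vV k)))] := nextP (k, V k) (VM k).
move=> /le_trans; apply; apply: lerD; last exact: ltW.
exact: (norm_center_refines (VM k.+1) (vV k.+1)).
Qed.

(** For the regular refinement [v], the center of any refinement [w] is a point
    of the core of [v] of the same norm as the center of [v], hence equal to it.
    So the center of [v] stays in the core of all refinements, and [v] cannot be
    infinitely often in a half-space that misses it. *)
Theorem bounded_weakly_cvg_refinement (M : R) u : eventually_bounded M u ->
  exists v z, refines v u /\ weakly_cvg v z.
Proof.
move=> /[dup] uM /exists_regular[v [vu vreg]].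
have vM : eventually_bounded M v by exact: refines_bounded uM.
exists v, (center v); split=> //.
have zcore w : refines w v -> tail_core w (center v).
  move=> wv; have [cw _] := center_nearest (refines_bounded wv vM).
  suff -> : center v = center w by [].
  have [cv vmin] := center_nearest vM.
  apply: (nearest_points_unique hr hX (C := tail_core v) (a := 0)) => //.
    exact: midconvex_tail_core.
  split; first exact: tail_core_refines cw.
  move=> y /vmin; apply: le_trans; rewrite !sub0r !normrN; exact: vreg.
have avoid B : closed B -> midconvex B -> ~ B (center v) ->
    \forall n \near \oo, ~ B (v n).
  move=> Bcl Bmid nBz; apply: contrapT.
  move=> /(@refine_frequently _ v (~` B))[w [wv wB]].
  have wB' : \forall n \near \oo, B (w n).
    by apply: nearW => n; exact: contrapT (wB n).
  exact: nBz (tail_core_sub Bcl Bmid wB' (zcore w wv)).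
move=> f fc; apply/cvgrPdist_lt => e e0.
have fmid (x y : X) : f (2^-1 *: (x + y)) = 2^-1 * (f x + f y) :> R.
  by rewrite linearZ linearD.
have ge : \forall n \near \oo, ~ (f (center v) + e <= f (v n) :> R).
  apply: (avoid [set y | f (center v) + e <= f y :> R]) => /=.
  - apply: (@preimage_closed _ _ f [set t : R | f (center v) + e <= t]).
      by move=> y _; exact: fc.
    exact: closed_ge.
  - by move=> x y /=; rewrite fmid; lra.
  - by move=> h; lra.
have le : \forall n \near \oo, ~ (f (v n) <= f (center v) - e :> R).
  apply: (avoid [set y | f y <= f (center v) - e :> R]) => /=.
  - apply: (@preimage_closed _ _ f [set t : R | t <= f (center v) - e]).
      by move=> y _; exact: fc.
    exact: closed_le.
  - by move=> x y /=; rewrite fmid; lra.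
  - by move=> h; lra.
apply: filterS2 ge le => n /negP; rewrite -ltNge => h1 /negP.
by rewrite -ltNge => h2; rewrite ltr_norml; apply/andP; split; lra.
Qed.

End WeakCompactness.

(** * Opial's property *)

(** Opial's property, in the form in which it is used: a point to which [v] is
    asymptotically no further than to its weak limit is that limit. *)
Lemma opial_eq {R : realType} {X : normedModType R} (v : nat -> X) (z y : X)
    (d : R^nat) : opial X -> weakly_cvg v z -> d @ \oo --> 0 ->
  (\forall n \near \oo, `|v n - y| <= `|v n - z| + d n) -> y = z.
Proof.
move=> hO vz d0 vd; apply: contrapT => yz.
have := hO v z vz y yz; rewrite ltNge => /negP; apply.
exact: limn_einf_le_vanishing d0 vd.
Qed.

(** * Orbits of quasi firmly nonexpansive operators *)

Section FixedPoints.
Context {R : realType} {X : completeNormedModType R} {r c alpha : R}.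
Context {T : X -> X}.
Hypotheses (hr : 2 <= r) (hX : uniformly_convex X r c).
Hypothesis hT : nonexpansive T.
Hypothesis hq : quasi_firmly_nonexpansive r c alpha T.

Let r_gt0 : 0 < r. Proof. exact: lt_le_trans hr. Qed.
Let c8_gt0 : 0 < c / 8. Proof. by case: hX => c0 _; lra. Qed.

Lemma nonexpansive_continuous : continuous T.
Proof.
move=> x; apply/cvgrPdist_lt => e e0; near=> y.
apply: le_lt_trans (hT _ _) _.
by near: y; apply/nbhs_ballP; exists e => // y; rewrite -ball_normE.
Unshelve. all: by end_near.
Qed.

Lemma closed_Fix : closed (Fix T).
Proof.
have -> : Fix T = (fun x => T x - x) @^-1` [set 0].
  apply/seteqP; split=> x /=; first by rewrite /Fix /= => ->; rewrite subrr.
  by move=> /eqP; rewrite subr_eq0 => /eqP.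
apply: preimage_closed; last first.
  by apply: accessible_closed_set1; exact/hausdorff_accessible/norm_hausdorff.
move=> x _; apply: cvgB; [exact: (@nonexpansive_continuous x)|exact: cvg_id].
Qed.

(** With [m] the midpoint of [p] and [q], nonexpansiveness bounds [|T m - p|]
    and [|q - T m|] by half of [|q - p|], whereas the sum of the two vectors is
    [q - p]. Strict convexity forces them to be equal. *)
Lemma midconvex_Fix : midconvex (Fix T).
Proof.
move=> p q Tp Tq; rewrite /Fix /=; set m := 2^-1 *: (p + q).
have half (x : X) : 2^-1 *: x + 2^-1 *: x = x.
  rewrite -scalerDl.
  by have -> : 2^-1 + 2^-1 = 1 :> R by [lra]; rewrite scale1r.
have mp : m - p = 2^-1 *: (q - p).
  rewrite -[X in _ - X](half p) /m scalerDr scalerBr opprD addrACA.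
  by rewrite subrr add0r.
have qm : q - m = 2^-1 *: (q - p).
  rewrite -[X in X - _](half q) /m scalerDr scalerBr opprD addrACA.
  by rewrite subrr addr0.
have up : `|T m - p| <= `|2^-1 *: (q - p)| by rewrite -{1}Tp -mp; exact: hT.
have uq : `|q - T m| <= `|2^-1 *: (q - p)| by rewrite -{1}Tq -qm; exact: hT.
have := @dist_midpoint _ _ _ _ hX 0 (T m - p) (q - T m).
have pw (u : X) :
    `|u| <= `|2^-1 *: (q - p)| -> `|u| `^ r <= `|2^-1 *: (q - p)| `^ r.
  by move=> ?; apply: ge0_ler_powR; rewrite ?nnegrE // ltW.
rewrite !sub0r !normrN [_ - p + _]addrC subrKA => h.
have := pw _ up; have := pw _ uq => h1 h2.
have : `|(T m - p) - (q - T m)| `^ r <= 0.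
  by rewrite -(pmulr_rle0 _ c8_gt0); lra.
rewrite le_eqVlt ltNge powR_ge0 orbF powR_eq0 normr_eq0 => /andP[/eqP e _].
have E : T m + T m = p + q.
  by apply/eqP; rewrite -subr_eq0 -e opprB opprD addrACA.
by rewrite -[LHS]half -scalerDr E.
Qed.

Section Orbit.
Variable x0 : X.
Let x n := iter n T x0.

Lemma fejer_monotone p : Fix T p ->
  {homo (fun n => `|x n - p|) : n m / (n <= m)%N >-> m <= n}.
Proof.
move=> Tp; apply: homo_leq => // [a b d ba cb|n]; first exact: le_trans cb ba.
by rewrite -{1}Tp; exact: hT.
Qed.

(** Firmness bounds [|x n - T (x n)| `^ r] by a multiple of a decrement of the
    convergent sequence [|x n - p| `^ r]. *)
Lemma asymptotically_regular : `|x n - T (x n)| @[n --> \oo] --> 0.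
Proof.
case: hq => /andP[a0 a1] [[p Tp] qT].
pose k := c / 2 * ((1 - alpha) / alpha).
have k0 : 0 < k.
  by case: hX => c0 _; rewrite mulr_gt0 ?divr_gt0 ?subr_gt0.
pose a n := `|x n - p| `^ r.
have adec : {homo a : n m / (n <= m)%N >-> m <= n}.
  move=> n m nm; apply: ge0_ler_powR; rewrite ?nnegrE //; first exact: ltW.
  exact: fejer_monotone.
have acvg : cvgn a.
  apply: nonincreasing_is_cvgn => //.
  by exists 0 => _ [n _ <-]; exact: powR_ge0.
have e0 : (fun n => a n - a n.+1) @ \oo --> 0.
  rewrite -(subrr (limn a)); apply: cvgB => //.
  by have := acvg; rewrite -[X in X -> _]cvg_shiftS.
apply/cvgrPdist_lt => eps eps0.
have := near_lt_of_powR_le r_gt0 k0 eps0 e0.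
apply: filterS => n h; rewrite sub0r normrN normr_id; apply: h => //.
have := qT (x n) p Tp; rewrite Tp subrr subr0 -/k /a /= => h.
by move: h; rewrite -/(x n); lra.
Qed.

(** For [n <= m] the projections of [x n] and [x m], and their midpoint, are all
    in [Fix T]; seen from [x m], the first is no further than [x n] is from [Fix T]
    and the midpoint no closer than the projection of [x m]. Hence
    [dist_midpoint] bounds their distance by a decrement of the convergent
    sequence [d]. *)
Lemma projections_cvg :
  exists2 p, Fix T p & metric_proj (Fix T) (x n) @[n --> \oo] --> p.
Proof.
have F0 : Fix T !=set0 by case: hq => _ [].
pose P n := metric_proj (Fix T) (x n).
have PP n : nearest_points (Fix T) (x n) (P n).
  exact: (metric_projP hr hX _ F0 closed_Fix midconvex_Fix).
pose d n := `|x n - P n| `^ r.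
have powle (t s : R) : 0 <= t -> t <= s -> t `^ r <= s `^ r.
  move=> t0 ts; apply: ge0_ler_powR; rewrite ?nnegrE //; first exact: ltW.
  exact: le_trans ts.
have xP n m : (n <= m)%N -> `|x m - P n| `^ r <= d n.
  move=> nm; apply: powle => //; apply: fejer_monotone => //.
  by have [] := PP n.
have ddec : {homo d : n m / (n <= m)%N >-> m <= n}.
  move=> n m nm; apply: le_trans (xP _ _ nm); apply: powle => //.
  by have [_] := PP m; apply; have [] := PP n.
have dcvg : cvgn d.
  apply: nonincreasing_is_cvgn => //.
  by exists 0 => _ [n _ <-]; exact: powR_ge0.
pose L : R := limn d.
have Ld m : L <= d m by exact: nonincreasing_cvgn_ge.
pose e (n : nat) : R := 2^-1 * (d n - L).
have e0 : e @ \oo --> 0.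
  rewrite -(mulr0 2^-1); apply: cvgMr; rewrite -(subrr L).
  by apply: cvgB => //; exact: cvg_cst.
have Pcvg : cvgn P.
  apply: (cvgn_of_powR_le hr c8_gt0 e0) => n m nm.
  have [Pn _] := PP n; have [Pm Pmin] := PP m.
  have := powle _ _ (normr_ge0 _) (Pmin _ (midconvex_Fix Pn Pm)).
  move=> /le_trans /(_ (dist_midpoint hX _ _ _)).
  have := xP _ _ nm; have := Ld m; rewrite /e -/(d m); lra.
exists (limn P) => //; apply: (closed_cvg _ closed_Fix _ _ Pcvg).
by apply: nearW => n; have [] := PP n.
Qed.

(** [T (v n)] is no further from [T z] than [v n] is from [z], and [v n] is
    asymptotic to [T (v n)]; so [opial_eq] applies to [T z]. *)
Lemma weak_limit_in_Fix (v : nat -> X) (z : X) : opial X ->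
  refines v x -> weakly_cvg v z -> Fix T z.
Proof.
move=> hO vx vz.
have d0 := refines_cvg (g := fun y => `|y - T y|) vx asymptotically_regular.
apply: (opial_eq hO vz d0); apply: nearW => n /=.
have -> : v n - T z = (T (v n) - T z) + (v n - T (v n)).
  by rewrite [RHS]addrC subrKA.
by apply: le_trans (ler_normD _ _) _; rewrite lerD2r; exact: hT.
Qed.

(** The projection of [v n], which is no further from [v n] than the fixed point
    [z], tends to [p]; so [opial_eq] applies to [p]. *)
Lemma weak_limit_projections (v : nat -> X) (z p : X) : opial X ->
  metric_proj (Fix T) (x n) @[n --> \oo] --> p ->
  refines v x -> weakly_cvg v z -> p = z.
Proof.
move=> hO Pp vx vz; have Tz := weak_limit_in_Fix hO vx vz.
pose P := metric_proj (Fix T).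
have d0 : `|P (x n) - p| @[n --> \oo] --> 0.
  rewrite -(@normr0 _ X) -(subrr p); apply: cvg_norm.
  by apply: cvgB => //; exact: cvg_cst.
apply: (opial_eq hO vz (refines_cvg (g := fun y => `|P y - p|) vx d0)).
apply: nearW => n /=.
have [|_ /(_ z Tz) Pz] := metric_projP hr hX (v n) _ closed_Fix midconvex_Fix.
  by exists z.
have -> : v n - p = (v n - P (v n)) + (P (v n) - p) by rewrite subrKA.
by apply: le_trans (ler_normD _ _) _; rewrite lerD2r.
Qed.

End Orbit.
End FixedPoints.

Theorem corollary5p5 (R : realType) (X : completeNormedModType R) (r c : R)
    (hr : 2 <= r) (hX : uniformly_convex X r c) (hO : opial X)
    (T : X -> X) (hT : nonexpansive T)
    (alpha : R) (hq : quasi_firmly_nonexpansive r c alpha T) (x0 : X) :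
  exists xstar : X,
    Fix T xstar /\
    weakly_cvg (fun n => iter n T x0) xstar /\
    metric_proj (Fix T) (iter n T x0) @[n --> \oo] --> xstar.
Proof.
have [p Tp Pp] := projections_cvg hr hX hT hq x0.
exists p; split=> //; split=> // f fc; apply/cvgrPdist_lt => e e0.
apply: contrapT.
move=> /(@refine_frequently _ _ [set y | `|f p - f y| < e])[v [vx vfar]].
have xM : eventually_bounded (`|x0 - p| + `|p|) (fun n => iter n T x0).
  apply: nearW => n; rewrite -[X in `|X|](subrK p).
  apply: le_trans (ler_normD _ _) _; rewrite lerD2r.
  exact: (fejer_monotone hT x0 Tp (leq0n n)).
have [w [z [wv wz]]] := bounded_weakly_cvg_refinement hr hX
  (refines_bounded vx xM).
have pz := weak_limit_projections hr hX hT hq hO Pp (refines_trans wv vx) wz.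
have /cvgrPdist_lt/(_ e e0) near_fp := wz f fc.
have far : \forall n \near \oo, ~ (`|f p - f (w n)| < e).
  have vfar' : \forall n \near \oo, ~ (`|f p - f (v n)| < e) by exact: nearW.
  exact: (wv [set y | ~ (`|f p - f y| < e)] vfar').
suff /filter_ex[] : \forall n \near \oo, False by [].
by apply: filterS2 far near_fp => n; rewrite -pz.
Qed.
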